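(* Let $m\ge 3$ be an integer. For real $r>0$ let $V_m(r)$ be the number of lattice points $(x_1,\ldots,x_m)\in\mathbb{Z}^m$ with $|x_i|\le r$ for all $1\le i\le m$ and $\gcd(x_1,\ldots,x_m)=1$, and let $$E_m(r)=V_m(r)-\frac{2^m}{\zeta(m)}r^m,$$ where $\zeta$ is the Riemann zeta function. Then $$E_m(r)=\Omega(r^{m-1})\quad (r\to\infty).$$
   Context: The symbol $\Omega$ is used in the sense of Hardy and Littlewood: $f(x)=\Omega(g(x))$ means $\limsup_{x\to\infty}\left|\frac{f(x)}{g(x)}\right|>0$. A lattice point $(x_1,\ldots,x_m)\in\mathbb{Z}^m$ is called visible from the origin if $\gcd(x_1,\ldots,x_m)=1$; thus $V_m(r)$ counts the visible lattice points in $[-r,r]^m$. *)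

(* Defs.v *)
From mathcomp Require Import all_boot all_order all_algebra.
From mathcomp Require Import finmap.
From mathcomp Require Import all_classical all_reals all_analysis.

Set Implicit Arguments.
Unset Strict Implicit.
Unset Printing Implicit Defensive.

Import Order.TTheory GRing.Theory Num.Theory.
Import numFieldNormedType.Exports.

Local Open Scope classical_set_scope.
Local Open Scope ring_scope.

(* Only meaningful for [1 < s], where the Dirichlet series converges;
   [riemannR s n] is [(n + 1) `^ (- s)], so the sum starts at 1. *)
Definition zeta (R : realType) (s : R) : R := limn (series (riemannR s)).

Definition visible (m : nat) (x : 'rV[int]_m) : bool :=
  \big[gcdz/0]_(i < m) x ord0 i == 1.

Definition visible_box (R : realType) (m : nat) (r : R) : set 'rV[int]_m :=
  [set x : 'rV[int]_m | (forall i, `|(x ord0 i)%:~R| <= r) /\ visible x].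
Arguments visible_box {R} m r _.

Lemma finite_visible_box (R : realType) (m : nat) (r : R) :
  finite_set (visible_box m r).
Proof.
pose N := Num.bound r.
pose g (y : 'rV['I_(N + N).+1]_m) : 'rV[int]_m :=
  \row_i ((y ord0 i : nat)%:Z - N%:Z).
apply: (@sub_finite_set _ _ (range g)); last exact/finite_image/finite_finset.
move=> x [xr _].
have xN i : (`|x ord0 i| <= N)%N.
  have := le_lt_trans (xr i) (archi_boundP (le_trans (normr_ge0 _) (xr i))).
  rewrite -intr_norm -[Num.bound r]/N -[N%:R]/(N%:Z%:~R) ltr_int -abszE ltz_nat.
  exact: ltnW.
exists (\row_i inord `|(x ord0 i + N%:Z)%R|%N) => //.
apply/rowP => i; rewrite !mxE.
have x0 : 0 <= x ord0 i + N%:Z.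
  by rewrite -lerBlDr sub0r; apply: lerNnormlW; rewrite -abszE lez_nat.
rewrite inordK; first by rewrite gez0_abs// addrK.
rewrite ltnS -lez_nat gez0_abs// PoszD lerD2r.
by apply: le_trans (ler_norm _) _; rewrite -abszE lez_nat.
Qed.

Definition visible_count (R : realType) (m : nat) (r : R) : nat :=
  #|` fset_set (visible_box m r)|%fset.

Definition visible_error (R : realType) (m : nat) (r : R) : R :=
  (visible_count m r)%:R - 2 ^+ m / zeta m%:R * r ^+ m.

(* The Hardy--Littlewood Omega as x tends to +oo: limsup |f / g| > 0.  The
   limsup is taken in the extended reals, so it may be +oo. *)
Definition Omega (R : realType) (f g : R -> R) : Prop :=
  (0 < limf_esup (fun x => (`|f x / g x|)%:E) (pinfty_nbhs R))%E.

(* Main.v *)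
Require Import Defs.
From mathcomp Require Import all_boot all_order all_algebra.
From mathcomp Require Import all_classical all_reals all_analysis.
From mathcomp Require Import ring lra.

Import Order.TTheory GRing.Theory Num.Theory.
Import numFieldNormedType.Exports.

Local Open Scope ring_scope.

(** The counting function V_m is constant on [n, n + 1), while the main term
    c r^m (c = 2^m / zeta(m)) grows there by an amount of order n^(m-1). Hence
    E_m(n) and E_m(n + 1/2) cannot both be small compared with n^(m-1). *)

(** The limsup is an infimum of suprema over neighbourhoods of [+oo]. Each of these contains a ray,
    hence a point where the quotient is at least [e], so the infimum is at least [e]. *)
Lemma frequently_Omega (R : realType) (f g : R -> R) (e : R) (e0 : 0 < e) :
  (forall M : R, exists2 x, M < x & e <= `|f x / g x|) -> Omega f g.
Proof.
move=> fg; rewrite /Omega limf_esupE.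
apply: (@lt_le_trans _ _ e%:E); first by rewrite lte_fin.
apply: le_ereal_inf_tmp => _ [A [M [_ MA]] <-].
have [x Mx ex] := fg M.
apply: (@le_trans _ _ (`|f x / g x|)%:E); first by rewrite lee_fin.
by apply: ereal_sup_ubound; exists x => //; exact: MA.
Qed.

(** Telescoping: for [x >= 1], [1/x^m <= 1/x^2 <= 2/(x(x + 1)) = 2/x - 2/(x + 1)]. *)
Lemma series_riemannR_le (R : realType) (m n : nat) : (2 <= m)%N ->
  series (riemannR (m%:R : R)) n <= 2 - 2 / n.+1%:R.
Proof.
move=> m2; elim: n => [|n IHn]; first by rewrite seriesEnat /= big_geq// divr1 subrr.
rewrite seriesSr /=; apply: le_trans (lerD IHn (lexx _)) _.
have n0 : 0 < n.+1%:R :> R by rewrite ltr0n.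
have n1 : 1 <= n.+1%:R :> R by rewrite ler1n.
have -> : n.+2%:R = n.+1%:R + 1 :> R by rewrite natr1.
rewrite /riemannR powR_mulrn ?(ltW n0)//.
have : (n.+1%:R ^+ m)^-1 <= (n.+1%:R ^+ 2)^-1 :> R.
  by rewrite lef_pV2 ?posrE ?exprn_gt0// ler_weXn2l.
move: (n.+1%:R) n0 n1 => x x0 x1 xm.
rewrite -subr_ge0; apply: (@le_trans _ _ ((x - 1) / (x ^+ 2 * (x + 1)))).
  by rewrite divr_ge0 ?subr_ge0// mulr_ge0 ?exprn_ge0 ?addr_ge0 ?(ltW x0).
suff -> : (x - 1) / (x ^+ 2 * (x + 1)) = 2 / x - 2 / (x + 1) - (x ^+ 2)^-1 by lra.
by field; apply/andP; split; apply: lt0r_neq0 => //; lra.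
Qed.

(** [limn] is informative only for a convergent sequence, so convergence comes first, from
    monotonicity and the bound 2; the limit then dominates the first partial sum. *)
Lemma zeta_gt0 (R : realType) (m : nat) : (2 <= m)%N -> 0 < zeta (m%:R : R).
Proof.
move=> m2; have sn : nondecreasing_seq (series (riemannR (m%:R : R))).
  apply/nondecreasing_seqP => n; rewrite seriesSr lerDl.
  by rewrite ltW// riemannR_gt0.
have sc : cvgn (series (riemannR (m%:R : R))).
  apply: nondecreasing_is_cvgn => //; exists 2 => _ [n _ <-].
  by apply: le_trans (series_riemannR_le R m n m2) _; rewrite gerBl divr_ge0.
apply: lt_le_trans (nondecreasing_cvgn_le sn sc 1%N).
by rewrite seriesEnat /= big_nat1 riemannR_gt0.
Qed.

Lemma visible_count_nat_half (R : realType) (m n : nat) :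
  visible_count m (n%:R + 2^-1 : R) = visible_count m (n%:R : R).
Proof.
have intP (k : int) : (`|k%:~R| <= n%:R + 2^-1 :> R) <-> (`|k%:~R| <= n%:R :> R).
  rewrite -intr_norm -abszE -[(`|k|%N)%:~R]/(`|k|%N%:R : R) ler_nat.
  split=> [|kn]; last by rewrite (@le_trans _ _ n%:R) ?ler_nat// lerDl invr_ge0.
  by rewrite -ltnS -(ltr_nat R) -(natr1 n) => kn; lra.
suff boxE : visible_box m (n%:R + 2^-1 : R) = visible_box m (n%:R : R).
  by rewrite /visible_count boxE.
by apply/seteqP; split=> x [xr xv]; split=> // i; apply/intP.
Qed.

Theorem theorem1p1 (R : realType) (m : nat) (hm : (3 <= m)%N) :
  Omega (fun r : R => visible_error m r) (fun r : R => r ^+ (m - 1)).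
Proof.
set c : R := 2 ^+ m / zeta m%:R.
have c0 : 0 < c by rewrite divr_gt0 ?exprn_gt0// zeta_gt0// ltnW.
have K0 : 0 < 2 ^+ (m - 1) :> R by rewrite exprn_gt0.
(* Chosen so that [e (1 + 2^(m-1)) = c/2], where [c/2 * n^(m-1)] bounds from below the growth of the
   main term from [n] to [n + 1/2]. *)
pose e := c / (2 * (1 + 2 ^+ (m - 1))).
have e0 : 0 < e by rewrite divr_gt0// mulr_gt0// addr_gt0.
apply: (@frequently_Omega _ _ _ e) => // M; pose n := (Num.bound `|M|).+1.
have Mn : M < n%:R.
  apply: le_lt_trans (ler_norm M) (lt_trans (archi_boundP (normr_ge0 M)) _).
  by rewrite ltr_nat.
have n1 : 1 <= n%:R :> R by rewrite ler1n.
have [|En] := leP e `|visible_error m n%:R / n%:R ^+ (m - 1)|; first by exists n%:R.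
exists (n%:R + 2^-1); first by lra.
rewrite leNgt; apply/negP => Eh.
have small (f x : R) : 0 < x -> `|f / x| < e -> `|f| < e * x.
  by move=> x0; rewrite normrM normfV (gtr0_norm x0) ltr_pdivrMr.
have xk0 : 0 < n%:R ^+ (m - 1) :> R by rewrite exprn_gt0//; lra.
have /small/(_ En) {}En := xk0.
have /small/(_ Eh) {}Eh : 0 < (n%:R + 2^-1) ^+ (m - 1) :> R.
  by rewrite exprn_gt0//; lra.
move: En Eh; rewrite /visible_error visible_count_nat_half -/c.
move: (visible_count m _)%:R => v.
have mE : m = (m - 1).+1 by rewrite subn1 prednK// ltnW// ltnW.
rewrite [in n%:R ^+ m]mE [in (_ + _) ^+ m]mE !exprS.
have ab : n%:R ^+ (m - 1) <= (n%:R + 2^-1) ^+ (m - 1) :> R.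
  by rewrite lerXn2r ?nnegrE; lra.
(* Since [n >= 1], [n + 1/2 <= 2n]. *)
have ba : (n%:R + 2^-1) ^+ (m - 1) <= 2 ^+ (m - 1) * n%:R ^+ (m - 1) :> R.
  by rewrite -exprMn lerXn2r ?nnegrE; lra.
have ec : e * (1 + 2 ^+ (m - 1)) = c / 2 by rewrite /e; field; lra.
move: xk0 K0 ec ab ba; move: (_ ^+ _) (_ ^+ _) (_ ^+ _) => b K a a0 K0 ec ab ba.
(* Here [a = n^(m-1)], [b = (n + 1/2)^(m-1)] and [K = 2^(m-1)]. Subtracting the lower bound at
   [n + 1/2] from the upper bound at [n] cancels the common count [v]: [c(n + 1/2)b - c n a < e a +
   e b <= e(1 + K)a = c a/2]. But [b >= a] makes the left side at least [c a/2]. *)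
rewrite !ltr_norml => /andP[_ vx] /andP[vy _].
have eba : e * b <= e * (K * a) by rewrite ler_wpM2l// (ltW e0).
have cab : c * ((n%:R + 2^-1) * a) <= c * ((n%:R + 2^-1) * b).
  by rewrite ler_wpM2l ?(ltW c0)// ler_wpM2l//; lra.
have eca : e * a + e * (K * a) = c / 2 * a by rewrite -ec; ring.
lra.
Qed.
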